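(* Let $A$ be a self-adjoint operator with domain $\mathcal D(A)$ in a Hilbert space $\mathcal H$ and let $B=B^*\in\mathscr B(\mathcal H)$ with $B\in C^1(A)$. (a) The operator $$\mathscr A_B\varphi:=(AB+BA)\varphi,\quad\varphi\in\mathcal D(A),$$ is essentially self-adjoint in $\mathcal H$, and its closure $A_B:=\overline{\mathscr A_B}$ has domain $$\mathcal D(A_B)=\big\{\varphi\in\mathcal H: B\varphi\in\mathcal D(A)\big\}.$$ (b) If $C\in\mathscr B(\mathcal H)$ satisfies $C\in C^1(A)$ and $[B,C]=0$, then $C\in C^1(A_B)$ with $[C,A_B]=[C,A]B+B[C,A]$.
   Context: $\mathscr B(\mathcal H)$ is the set of bounded operators on $\mathcal H$, whose scalar product $\langle\cdot,\cdot\rangle$ is antilinear in the first argument. For a self-adjoint operator $A$ and $S\in\mathscr B(\mathcal H)$ one writes $S\in C^1(A)$ if $\mathbb R\ni t\mapsto e^{-itA}Se^{itA}\in\mathscr B(\mathcal H)$ is strongly of class $C^1$, equivalently if the quadratic form $\mathcal D(A)\ni\varphi\mapsto\langle\varphi,SA\varphi\rangle-\langle A\varphi,S\varphi\rangle\in\mathbb C$ is continuous for the topology induced by $\mathcal H$ on $\mathcal D(A)$; $[S,A]$ denotes the bounded operator associated with the continuous extension of this form. *)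

(* Defs.v *)
From HB Require Import structures.
From mathcomp Require Import all_boot all_order all_algebra.
From mathcomp Require Import all_classical all_reals all_analysis.
From mathcomp Require Import complex sesquilinear.

Set Implicit Arguments.
Unset Strict Implicit.
Unset Printing Implicit Defensive.

Import Order.TTheory GRing.Theory Num.Theory Num.Def.
Import numFieldNormedType.Exports.

Local Open Scope classical_set_scope.
Local Open Scope complex_scope.
Local Open Scope ring_scope.

(* Complex Hilbert spaces.  The positive definite forms [{dot H for conjC}] of
   the library are linear in the first argument and antilinear in the second;
   [inner] below swaps the arguments. *)
HB.mixin Record CompleteNormedModule_isHilbert (R : realType) H
    of CompleteNormedModule R[i] H := {
  hdot : {dot H for @conjC R[i]} ;
  hdot_norm : forall x : H, hdot x x = `|x| ^+ 2
}.

#[short(type="hilbertType")]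
HB.structure Definition Hilbert (R : realType) :=
  {H of CompleteNormedModule R[i] H & CompleteNormedModule_isHilbert R H}.

Section Operators.
Context {R : realType} {H : hilbertType R}.

Definition inner (x y : H) : R[i] := hdot y x.

Definition bounded_operator (S : H -> H) : Prop :=
  linear S /\ exists M : R, forall x, `|S x| <= M%:C * `|x|.

Definition bounded_selfadjoint (S : H -> H) : Prop :=
  bounded_operator S /\ forall x y, inner x (S y) = inner (S x) y.

(* A partially defined operator; the values of [app] outside [dom] are
   irrelevant. *)
Record operator := Operator { dom : set H ; app :> H -> H }.

Definition linear_operator (T : operator) : Prop :=
  dom T 0 /\
  forall (a : R[i]) x y, dom T x -> dom T y ->
    dom T (a *: x + y) /\ T (a *: x + y) = a *: T x + T y.

Definition graph (T : operator) : set (H * H) :=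
  [set p | dom T p.1 /\ p.2 = T p.1].

(* The operator with graph [G], when [G] is single-valued. *)
Definition operator_of_graph (G : set (H * H)) : operator :=
  Operator [set x | exists y, G (x, y)] (fun x => xget 0 [set y | G (x, y)]).

Definition adjoint_graph (T : operator) : set (H * H) :=
  [set p | forall x, dom T x -> inner p.1 (T x) = inner p.2 x].

Definition selfadjoint (T : operator) : Prop :=
  [/\ linear_operator T, dense (dom T) & adjoint_graph T = graph T].

Definition closable (T : operator) : Prop :=
  forall y, closure (graph T) (0, y) -> y = 0.

Definition operator_closure (T : operator) : operator :=
  operator_of_graph (closure (graph T)).

Definition essentially_selfadjoint (T : operator) : Prop :=
  [/\ linear_operator T, closable T & selfadjoint (operator_closure T)].

Definition commutator_form (S : H -> H) (A : operator) (x : H) : R[i]^o :=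
  inner x (S (A x)) - inner (A x) (S x).

Definition C1 (A : operator) (S : H -> H) : Prop :=
  {within dom A, continuous (commutator_form S A)}.

(* [S, A]: the bounded operator whose quadratic form extends
   [commutator_form S A].  It exists and is unique when [C1 A S] and [A] is
   densely defined. *)
Definition commutator (S : H -> H) (A : operator) : H -> H :=
  xget (fun=> 0) [set T | bounded_operator T /\
    forall x, dom A x -> inner x (T x) = commutator_form S A x].

Definition anticommutator (A : operator) (B : H -> H) : operator :=
  Operator (dom A) (fun x => A (B x) + B (A x)).

End Operators.

Arguments operator {R} H.

(* Main.v *)
Require Import Defs.
From mathcomp Require Import all_boot all_order all_algebra.
From mathcomp Require Import all_classical all_reals all_analysis.
From mathcomp Require Import complex sesquilinear lra ring.

Set Implicit Arguments.
Unset Strict Implicit.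
Unset Printing Implicit Defensive.

Import Order.TTheory GRing.Theory Num.Theory Num.Def.
Import numFieldNormedType.Exports.

Local Open Scope classical_set_scope.
Local Open Scope complex_scope.
Local Open Scope ring_scope.

(** Let [K := [B, A]], a bounded operator.  On the domain of [A] one has
    [AB = BA - K], so that [AB + BA = 2 BA - K], and also [AB + BA = 2 AB + K].
    The second formula makes sense on [{phi | B phi \in D(A)}]; call [T] the
    operator [2 AB + K] with that domain.

    The adjoint of [AB + BA] is exactly [T]: since [B] is symmetric and [K] is
    anti-symmetric, testing [phi] against [2 BA - K] amounts to testing
    [2 B phi] against [A], and [A] is its own adjoint
    ([adjoint_graph_anticommutator]).  An adjoint is closed, so the closure of
    [AB + BA] is contained in [T].  Conversely every [phi] in the domain of [T]
    is approximated, in the graph norm, by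
    [z_n := (1 + i A / (n + 1))^-1 phi], which lies in [D(A)]: commuting [B]
    with the resolvent produces only an error term
    [(1 - (1 + i A / (n + 1))^-1) K z_n], which tends to zero because the
    resolvents tend strongly to the identity
    ([closure_graph_anticommutator]).  Hence the closure is [T], it coincides
    with the adjoint of [AB + BA], and it is therefore self-adjoint.

    For [C] commuting with [B], the operator [C] preserves the domain of [T],
    and the commutator of [C] with [2 AB + K] is [2 [C, A] B + [C, K]]; the
    Jacobi identity [[C, [B, A]] = [B, [C, A]]] turns this into
    [[C, A] B + B [C, A]], which is bounded ([jacobi_commutator],
    [commutator_form_closure_anticommutator]).

    Three facts of Hilbert space theory carry this.  A form of Riesz's
    theorem, proved by minimising a quadratic functional ([riesz]), yields both
    the surjectivity of [1 + i t A] ([resolvent_exists]) and the bounded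
    operator attached to a bounded sesquilinear form
    ([bounded_form_operator]).  The polarization identity transfers continuity
    at zero of the quadratic form of [C1] into a bound on the sesquilinear form
    ([continuous_form_bounded]).  It follows that operators in [C1 A] preserve
    the domain of [A] ([C1_dom]). *)

(** * Inner product and norm as real quantities *)

Section InnerProduct.
Context {R : realType} {H : hilbertType R}.
Implicit Types (x y z : H) (a : R[i]).

Lemma innerDr x y z : inner x (y + z) = inner x y + inner x z.
Proof. by rewrite /inner linearDl. Qed.

Lemma innerDl x y z : inner (x + y) z = inner x z + inner y z.
Proof. by rewrite /inner linearDr. Qed.

Lemma innerZr a x y : inner x (a *: y) = a * inner x y.
Proof. by rewrite /inner linearZl_LR. Qed.

Lemma innerZl a x y : inner (a *: x) y = a^*%C * inner x y.
Proof. by rewrite /inner linearZr_LR. Qed.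

Lemma innerC x y : inner y x = (inner x y)^*%C.
Proof. by rewrite /inner hermC expr0 mul1r. Qed.

Lemma innerNr x y : inner x (- y) = - inner x y.
Proof. by rewrite -scaleN1r innerZr mulN1r. Qed.

Lemma innerNl x y : inner (- x) y = - inner x y.
Proof. by rewrite innerC innerNr innerC rmorphN /= conjcK. Qed.

Lemma innerBr x y z : inner x (y - z) = inner x y - inner x z.
Proof. by rewrite innerDr innerNr. Qed.

Lemma innerBl x y z : inner (x - y) z = inner x z - inner y z.
Proof. by rewrite innerDl innerNl. Qed.

Lemma inner0r x : inner x 0 = 0.
Proof. by rewrite -(scale0r 0) innerZr mul0r. Qed.

Lemma inner_self x : inner x x = `|x| ^+ 2.
Proof. exact: hdot_norm. Qed.

(** The norm takes its values in the partially ordered field [R[i]]; [rnorm]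
    and [rinner] take theirs in [R], where infima and the comparison of
    quadratic expressions make sense. *)
Definition rnorm (x : H) : R := complex.Re `|x|.

Lemma rnormE x : `|x| = (rnorm x)%:C.
Proof. by rewrite /rnorm RRe_real // ger0_real. Qed.

Lemma rnorm_ge0 x : 0 <= rnorm x.
Proof. by rewrite -ler0c -rnormE. Qed.

Definition rinner x y : R := complex.Re (inner x y).

Lemma rinner_self x : rinner x x = rnorm x ^+ 2.
Proof. by rewrite /rinner inner_self rnormE -rmorphXn /=. Qed.

Lemma rnorm_eq0 x : rnorm x = 0 -> x = 0.
Proof. by move=> x0; apply/normr0_eq0; rewrite rnormE x0. Qed.

Lemma rnormD x y : rnorm (x + y) <= rnorm x + rnorm y.
Proof. by rewrite -lecR rmorphD /= -!rnormE ler_normD. Qed.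

Lemma rnormN x : rnorm (- x) = rnorm x.
Proof. by rewrite /rnorm normrN. Qed.

Lemma rnormB x y : rnorm (x - y) = rnorm (y - x).
Proof. by rewrite /rnorm distrC. Qed.

Lemma rnormZ (t : R) x : rnorm (t%:C *: x) = `|t| * rnorm x.
Proof.
apply: complexI; rewrite rmorphM /= -!rnormE normrZ; congr (_ * _).
by rewrite normc_def /= expr0n addr0 sqrtr_sqr.
Qed.

Lemma rnorm_sqrZ (t : R) x : rnorm (t%:C *: x) ^+ 2 = t ^+ 2 * rnorm x ^+ 2.
Proof. by rewrite rnormZ exprMn real_normK ?num_real. Qed.

Lemma rnormZi x : rnorm ('i *: x) = rnorm x.
Proof.
by rewrite /rnorm normrZ normc_def /= expr0n expr1n add0r sqrtr1 mul1r.
Qed.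

Lemma rinnerC x y : rinner y x = rinner x y.
Proof. by rewrite /rinner innerC; case: (inner x y). Qed.

Lemma ReD a b : complex.Re (a + b) = complex.Re a + complex.Re b.
Proof. by case: a; case: b. Qed.

Lemma rinnerDr x y z : rinner x (y + z) = rinner x y + rinner x z.
Proof. by rewrite /rinner innerDr ReD. Qed.

Lemma rinnerDl x y z : rinner (x + y) z = rinner x z + rinner y z.
Proof. by rewrite /rinner innerDl ReD. Qed.

Lemma rinnerZr (t : R) x y : rinner x (t%:C *: y) = t * rinner x y.
Proof.
by rewrite /rinner innerZr; case: (inner x y) => u v /=; rewrite mul0r subr0.
Qed.

Lemma rinnerZl (t : R) x y : rinner (t%:C *: x) y = t * rinner x y.
Proof. by rewrite rinnerC rinnerZr rinnerC. Qed.

Lemma rinnerBr x y z : rinner x (y - z) = rinner x y - rinner x z.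
Proof. by rewrite /rinner innerBr ReD; case: (inner x z). Qed.

Lemma Im_inner x y : complex.Im (inner x y) = rinner ('i *: x) y.
Proof.
rewrite /rinner innerZl; case: (inner x y) => u v /=.
by rewrite mul0r add0r mulN1r opprK.
Qed.

Lemma rnorm_sqrD x y :
  rnorm (x + y) ^+ 2 = rnorm x ^+ 2 + rnorm y ^+ 2 + 2 * rinner x y.
Proof.
rewrite -!rinner_self rinnerDr !rinnerDl (rinnerC x y).
by ring.
Qed.

Lemma rinner_le x y : rinner x y <= rnorm x * rnorm y.
Proof.
have h := rnormD x y; have := rnorm_sqrD x y.
have := rnorm_ge0 (x + y); have := rnorm_ge0 x; have := rnorm_ge0 y.
by nra.
Qed.

Lemma rinner_ge x y : - (rnorm x * rnorm y) <= rinner x y.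
Proof.
have := rinner_le (- x) y; rewrite rnormN /rinner innerNl.
by case: (inner x y) => /= u v; lra.
Qed.

(** Rotating [x] by the conjugate phase of [inner x y] makes the inner product
    real, which reduces the complex inequality to [rinner_le]. *)
Lemma norm_inner_le x y : `|inner x y| <= `|x| * `|y|.
Proof.
set z := inner x y; set r := complex.Re `|z|.
have zr : `|z| = r%:C by rewrite /r RRe_real // ger0_real.
have r0 : 0 <= r by rewrite -ler0c -zr.
have : r ^+ 2 <= r * (rnorm x * rnorm y).
  have <- : rinner (z *: x) y = r ^+ 2.
    by rewrite /rinner innerZl -/z mulrC -sqr_normc zr -rmorphXn.
  rewrite mulrA; suff <- : rnorm (z *: x) = r * rnorm x by exact: rinner_le.
  by apply: complexI; rewrite rmorphM /= -!rnormE normrZ zr.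
rewrite zr !rnormE -rmorphM lecR.
case: (ltrgtP r 0) r0 => // [r0 _|-> _ _]; first by rewrite expr2 ler_pM2l.
by rewrite mulr_ge0 ?rnorm_ge0.
Qed.

Lemma cvg_rnormP {T : Type} (F : set_system T) {FF : Filter F} (u : T -> H) l :
  u @ F --> l <->
  forall e : R, 0 < e -> \forall t \near F, rnorm (l - u t) < e.
Proof.
split.
  move=> /cvgrPdist_lt h e e0.
  have := h e%:C; rewrite ltcR => /(_ e0).
  by apply: filterS => n; rewrite rnormE ltcR.
move=> h; apply/cvgrPdist_lt => -[e f]; rewrite ltcE /= => /andP[/eqP f0 e0].
rewrite f0 complexr0.
by move: (h e e0); apply: filterS => n; rewrite rnormE ltcR.
Qed.

Lemma rnorm_complete (u : nat -> H) :
  (forall e : R, 0 < e -> exists N, forall n m, (N <= n)%N -> (N <= m)%N ->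
     rnorm (u n - u m) < e) ->
  exists l : H, u @ \oo --> l.
Proof.
move=> h; suff uc : cvgn u by exists (limn u).
apply/cauchy_cvgP/cauchy_ballP.
move=> -[e f]; rewrite ltcE /= => /andP[/eqP f0 e0].
rewrite f0 complexr0; have [N hN] := h _ e0.
exists (u @` [set n | (N <= n)%N], u @` [set n | (N <= n)%N]) => /=.
  by split; exists N => // n Nn; exists n.
move=> [_ _] [/= [n Nn <-] [m Nm <-]]; rewrite -ball_normE /= rnormE ltcR.
exact: hN.
Qed.

Lemma cvg_inner {T : Type} (F : set_system T) {FF : Filter F}
    (f g : T -> H) x y : f @ F --> x -> g @ F --> y ->
  (fun t => inner (f t) (g t) : R[i]^o) @ F --> (inner x y : R[i]^o).
Proof.
move=> fx gy.
have h0 : (fun t => `|x - f t| * `|g t| + `|x| * `|y - g t| : R[i]^o) @ F -->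
    (0 : R[i]^o).
  rewrite (_ : 0 = `|x - x| * `|y| + `|x| * `|y - y|); last first.
    by rewrite !subrr !normr0 mul0r mulr0 addr0.
  apply: cvgD; apply: cvgM; [|exact: cvg_norm|exact: cvg_cst|];
    by apply: cvg_norm; apply: cvgB => //; exact: cvg_cst.
apply/cvgrPdist_lt => e e0.
move/cvgr0Pnorm_lt: h0 => /(_ e e0); apply: filterS => t.
apply: le_lt_trans.
have -> : inner x y - inner (f t) (g t) =
    inner (x - f t) (g t) + inner x (y - g t).
  by rewrite innerBl innerBr [RHS]addrC addrA subrK.
rewrite [leRHS]ger0_norm ?addr_ge0 ?mulr_ge0 //.
by apply: le_trans (ler_normD _ _) _; apply: lerD; exact: norm_inner_le.
Qed.

Lemma dense_rnorm (D : set H) : dense D ->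
  forall x (e : R), 0 < e -> exists2 y, D y & rnorm (x - y) < e.
Proof.
move=> dD x e e0.
have [||y [xy Dy]] := dD (ball x e%:C).
- by exists x; apply: ballxx; rewrite ltcR.
- exact: ball_open.
exists y => //; by move: xy; rewrite -ball_normE /= rnormE ltcR.
Qed.

Lemma ge_rinner_cvg y (u : nat -> H) l (t : R) :
  u @ \oo --> l -> (forall e : R, 0 < e -> exists N, forall n, (N <= n)%N ->
     t - e <= rinner y (u n)) -> t <= rinner y l.
Proof.
move=> /cvg_rnormP ul h; apply/ler_addgt0Pr => e e0.
have M0 : 0 < rnorm y + 1 by have := rnorm_ge0 y; lra.
have e1 : 0 < e / 2 / (rnorm y + 1) by rewrite !divr_gt0.
have [N1 _ h1] := ul _ e1.
have [N2 h2] := h (e / 2) ltac:(by lra).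
have /= := h1 (maxn N1 N2) (leq_maxl _ _).
have := h2 (maxn N1 N2) (leq_maxr _ _).
set v := u _; rewrite ltr_pdivlMr // => tv lv.
have := rinner_ge y (l - v); rewrite rinnerBr.
have := rnorm_ge0 (l - v); have := rnorm_ge0 y.
nra.
Qed.

Lemma invS_small (e : R) : 0 < e ->
  exists N, forall n, (N <= n)%N -> (n.+1%:R^-1 : R) < e.
Proof.
by move=> e0; have [N _ hN] := near_infty_natSinv_lt (PosNum e0); exists N.
Qed.

Lemma dense_seq (D : set H) x : dense D ->
  exists2 u : nat -> H, forall n, D (u n) & u @ \oo --> x.
Proof.
move=> dD.
have /choice[u hu] : forall n, exists y, D y /\ rnorm (x - y) < n.+1%:R^-1.
  by move=> n; have [|y Dy xy] := dense_rnorm dD x (e := n.+1%:R^-1) _;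
    rewrite ?invr_gt0 //; exists y.
exists u => [n|]; first exact: (hu n).1.
apply/cvg_rnormP => e /invS_small[N hN]; exists N => // n /= Nn.
exact: lt_trans (hu n).2 (hN n Nn).
Qed.

(** * Riesz's theorem, bounded sesquilinear forms and their operators *)

(** The functional [f], antilinear on a subspace [D] and bounded in terms of
    [L v], is represented by a vector of [H]: a minimizing sequence [w n] of
    [J v = |L v|^2 - 2 Re (f v)] makes [L (w n)] a Cauchy sequence by the
    parallelogram identity, and the vanishing of the first variation of [J] says
    that its limit represents [f].  Allowing an arbitrary linear [L] in place
    of the inclusion of [D] lets the same statement produce resolvents. *)
Lemma riesz (V : lmodType R[i]) (D : set V) (L : V -> H) (f : V -> R[i])
    (c : R) :
  D 0 ->
  (forall a v w, D v -> D w ->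
     D (a *: v + w) /\ L (a *: v + w) = a *: L v + L w /\
     f (a *: v + w) = a^*%C * f v + f w) ->
  (forall v, D v -> complex.Re (f v) <= c * rnorm (L v)) ->
  exists z, forall v, D v -> inner (L v) z = f v.
Proof.
move=> D0 DL fc.
pose J v : R := rnorm (L v) ^+ 2 - 2 * complex.Re (f v).
pose E := [set J v | v in D].
have Jlb v : D v -> - c ^+ 2 <= J v.
  move=> Dv; have := fc v Dv; have := sqr_ge0 (rnorm (L v) - c).
  by rewrite /J; lra.
have hE : has_inf E.
  split; first by exists (J 0); exists 0.
  by exists (- c ^+ 2) => _ [v Dv <-]; exact: Jlb.
pose m := inf E.
have mJ v : D v -> m <= J v.
  by move=> Dv; apply: ge_inf; [exact: hE.2|exists v].
have /choice[w hw] : forall n, exists v, D v /\ J v < m + n.+1%:R^-1.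
  move=> n; have [|_ [v Dv <-] Jv] := @inf_adherent _ E n.+1%:R^-1 _ hE.
    by rewrite invr_gt0.
  by exists v.
have DZ a v : D v ->
    [/\ D (a *: v), L (a *: v) = a *: L v & f (a *: v) = a^*%C * f v].
  (* Linearity at zero vectors gives [L 0 = 0] and [f 0 = 0]. *)
  move=> Dv; have := DL a v 0 Dv D0; have := DL 1 0 0 D0 D0.
  rewrite !scale1r !addr0 => -[_ [+ +]].
  rewrite -[in X in X -> _]/(1^*)%C rmorph1 mul1r.
  move=> /eqP; rewrite eq_sym -subr_eq0 addrK => /eqP L0.
  move=> /eqP; rewrite eq_sym -subr_eq0 addrK => /eqP f0.
  by rewrite L0 f0 !addr0 => -[? []].
have DD v v' : D v -> D v' ->
    [/\ D (v + v'), L (v + v') = L v + L v' & f (v + v') = f v + f v'].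
  move=> Dv Dv'; have := DL 1 v v' Dv Dv'.
  by rewrite !scale1r conjc1 mul1r => -[? []].
have ReM (t : R) (z : R[i]) : complex.Re ((t%:C)^*%C * z) = t * complex.Re z.
  by case: z => ? ?; rewrite /= oppr0 mul0r subr0.
have Jexp v v' (t : R) : D v -> D v' ->
    m <= J v + t ^+ 2 * rnorm (L v') ^+ 2 +
      2 * t * (rinner (L v') (L v) - complex.Re (f v')).
  move=> Dv Dv'; have [Dt Lt ft] := DZ t%:C v' Dv'.
  have [Ds Ls fs] := DD _ _ Dv Dt.
  apply: le_trans (mJ _ Ds) _.
  rewrite /J Ls Lt fs ft ReD ReM rnorm_sqrD rnorm_sqrZ rinnerZr.
  by rewrite (rinnerC (L v')); lra.
have Jpar v v' : D v -> D v' ->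
    rnorm (L v - L v') ^+ 2 = 2 * J v + 2 * J v' - 4 * J (2^-1%:C *: (v + v')).
  move=> Dv Dv'; have [Ds Ls fs] := DD _ _ Dv Dv'.
  have [Dt Lt ft] := DZ 2^-1%:C _ Ds.
  rewrite /J Lt ft ReM Ls fs ReD rnorm_sqrZ !rnorm_sqrD rnormN.
  have -> : rinner (L v) (- L v') = - rinner (L v) (L v').
    by rewrite -[- L v']add0r rinnerBr /rinner inner0r /= sub0r.
  by field.
have [z zP] : exists z : H, L \o w @ \oo --> z.
  apply: rnorm_complete => e e0.
  have [|N hN] := @invS_small (e ^+ 2 / 4).
    by rewrite divr_gt0 // exprn_gt0.
  exists N => n k Nn Nk.
  have [[Dn Jn] [Dk Jk]] := (hw n, hw k).
  have n1 := hN n Nn; have k1 := hN k Nk.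
  have [Ds _ _] := DD _ _ Dn Dk.
  have [Dt _ _] := DZ 2^-1%:C _ Ds; have m1 := mJ _ Dt.
  rewrite -(@ltr_pXn2r _ 2) ?nnegrE ?rnorm_ge0 ?(ltW e0) //=.
  rewrite Jpar //; move: Jn Jk n1 k1 m1.
  by move: (n.+1%:R^-1) (k.+1%:R^-1) => p q; lra.
have Re_eq v : D v -> rinner (L v) z = complex.Re (f v).
  move=> Dv; set a := rnorm (L v) ^+ 2; set F := complex.Re _.
  have quad (t : R) : 0 <= t ^+ 2 * a + 2 * t * (rinner (L v) z - F).
    have : - (t ^+ 2 * a) + 2 * t * F <= rinner ((2 * t)%:C *: L v) z.
      apply: ge_rinner_cvg zP _ => e /invS_small[N hN].
      exists N => n Nn; have [Dn Jn] := hw n; have /= := hN n Nn.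
      have := Jexp _ _ t Dn Dv; rewrite -/a -/F rinnerZl; move: Jn.
      by move: (n.+1%:R^-1) => p; lra.
    by rewrite rinnerZl; lra.
  set d := rinner _ _ - F in quad; suff : d = 0 by rewrite /d => /subr0_eq.
  have a0 : 0 <= a by exact: sqr_ge0.
  (* The minimum over [t] is at [- d / a]; dividing by [a + 1] instead covers
     the case [a = 0] and still gives a negative value unless [d = 0]. *)
  have := quad (- d / (a + 1)).
  have -> : (- d / (a + 1)) ^+ 2 * a + 2 * (- d / (a + 1)) * d =
    - (d ^+ 2 * ((a + 2) / (a + 1) ^+ 2)) by field; lra.
  rewrite oppr_ge0 pmulr_lle0; last by rewrite divr_gt0 ?exprn_gt0 //; lra.
  move=> h; apply/eqP; rewrite -sqrf_eq0; apply/eqP/le_anti.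
  by rewrite h sqr_ge0.
exists z => v Dv; apply/eqP; rewrite eq_complex Im_inner.
have [Di Li fi] := DZ 'i v Dv.
rewrite -[complex.Re (inner _ _)]/(rinner _ _) Re_eq // eqxx /=.
rewrite -Li Re_eq // fi; case: (f v) => p q /=.
by rewrite mul0r mulN1r opprK add0r.
Qed.

End InnerProduct.

Section Forms.
Context {R : realType} {H : hilbertType R}.
Implicit Types (x y z v : H) (a : R[i]) (D : set H).

Definition subspace_of D : Prop :=
  D 0 /\ forall a x y, D x -> D y -> D (a *: x + y).

Definition sesquilinear_on D (s : H -> H -> R[i]) : Prop :=
  forall a x y z, D x -> D y -> D z ->
    s x (a *: y + z) = a * s x y + s x z /\
    s (a *: y + z) x = a^*%C * s y x + s z x.

Lemma dense_rnorm_le D z (c : R) : dense D -> 0 <= c ->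
  (forall x, D x -> rinner x z <= c * rnorm x) -> rnorm z <= c.
Proof.
move=> dD c0 h; rewrite leNgt; apply/negP => cz.
have e0 : 0 < rnorm z * (rnorm z - c) / (2 * (rnorm z + c)).
  by rewrite divr_gt0 ?mulr_gt0 //; lra.
have [y Dy zy] := dense_rnorm dD z e0.
move: zy; rewrite ltr_pdivlMr; last by lra.
have := h y Dy; have := rinner_le z (z - y); rewrite rinnerBr rinner_self.
rewrite (rinnerC z y); have := rnormD z (y - z); rewrite addrC subrK.
rewrite (rnormB y z); have := rnorm_ge0 (z - y).
nra.
Qed.

Lemma dense_inner_eq D x y : dense D ->
  (forall z, D z -> inner z x = inner z y) -> x = y.
Proof.
move=> dD h; apply/subr0_eq/rnorm_eq0/le_anti; rewrite rnorm_ge0 andbT.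
apply: (dense_rnorm_le dD) => // z Dz.
by rewrite /rinner innerBr h // subrr /= mul0r.
Qed.

Lemma conjcN a : (- a)^*%C = - a^*%C.
Proof. exact: rmorphN. Qed.

(** The values at [1] and [- 1] isolate [s x y + s y x], those at ['i] and
    [- 'i] isolate [s x y - s y x], because [s] is antilinear in its first
    argument. *)
Lemma polarization D s : subspace_of D -> sesquilinear_on D s ->
  forall x y, D x -> D y -> 4 * s x y =
    s (1 *: y + x) (1 *: y + x) - s (- 1 *: y + x) (- 1 *: y + x) -
    'i * (s ('i *: y + x) ('i *: y + x) - s (- 'i *: y + x) (- 'i *: y + x)).
Proof.
move=> [_ Ds] hs x y Dx Dy.
have e a : s (a *: y + x) (a *: y + x) =
    a * (a^*%C * s y y + s x y) + (a^*%C * s y x + s x x).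
  have Dv := Ds a y x Dy Dx.
  have [-> _] := hs a _ y x Dv Dy Dx.
  have [_ ->] := hs a y y x Dy Dy Dx.
  by have [_ ->] := hs a x y x Dx Dy Dx.
rewrite !e !conjcN conjc1.
have -> : 'i^*%C = - 'i :> R[i] by apply/eqP; rewrite eq_complex /= oppr0 !eqxx.
have i2 : 'i * 'i = - 1 :> R[i] by rewrite -expr2 sqr_i.
set u := s y y; set v := s x y; set w := s y x; set r := s x x.
ring: i2.
Qed.

Lemma Re_le_norm (a : R[i]) (r : R) : `|a| <= r%:C -> complex.Re a <= r.
Proof.
move=> ar; rewrite -lecR; apply: (le_trans _ ar).
apply: (le_trans _ (normc_ge_Re _)).
by rewrite lecR ler_norm.
Qed.

(** Continuity at the origin bounds the quadratic form by 1 on a ball of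
    radius [d]; polarization bounds [s x y] by 1 when [x] and [y] are of norm at
    most [d / 3], so that the four vectors [a *: y + x] stay in the ball, and
    scaling does the rest. *)
Lemma continuous_form_bounded D (s : H -> H -> R[i]) :
  subspace_of D -> sesquilinear_on D s ->
  {within D, continuous (fun x => s x x : R[i]^o)} ->
  exists2 M : R, 0 <= M & forall x y, D x -> D y ->
    `|s x y| <= (M * rnorm x * rnorm y)%:C.
Proof.
move=> sD hs qc; have [D0 DD] := sD.
have s0 x : D x -> s x 0 = 0 /\ s 0 x = 0.
  (* The coefficient [-1] makes both equations of sesquilinearity collapse. *)
  move=> Dx; have := hs (-1) x 0 0 Dx D0 D0.
  by rewrite scaler0 addr0 conjcN conjc1 !mulN1r !addNr.
have [d d0 hd] : exists2 d : R, 0 < d & forall x, D x -> rnorm x < d ->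
    `|s x x| < 1.
  move/subspace_continuousP: qc => /(_ 0 D0).
  move=> /cvgrPdist_lt/(_ 1 ltr01); rewrite /from_subspace (s0 0 D0).1.
  rewrite /within /= => /nbhs_ballP[/= [e f]].
  rewrite ltcE /= => /andP[/eqP f0 e0].
  rewrite f0 complexr0 => he; exists e => // x Dx xe.
  have := he x; rewrite sub0r normrN; apply => //.
  by rewrite -ball_normE /= sub0r normrN rnormE ltcR.
have DZ t x : D x -> D (t *: x) by move=> Dx; rewrite -[_ *: _]addr0; exact: DD.
pose h := d / 3.
have h0 : 0 < h by rewrite divr_gt0.
have small x y : D x -> D y -> rnorm x <= h -> rnorm y <= h -> `|s x y| <= 1.
  move=> Dx Dy xh yh.
  have q1 a : `|a| = 1 -> `|s (a *: y + x) (a *: y + x)| <= 1.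
    move=> a1; apply/ltW/hd; first exact: DD.
    apply: le_lt_trans (rnormD _ _) _.
    have -> : rnorm (a *: y) = rnorm y by rewrite /rnorm normrZ a1 mul1r.
    by rewrite /h in xh yh h0; lra.
  have i1 : `|'i| = 1 :> R[i].
    by rewrite normc_def /= expr0n expr1n add0r sqrtr1.
  have n4 : `|4| = 4 :> R[i] by rewrite ger0_norm.
  rewrite -(@ler_pM2l _ 4) // mulr1 -[X in X * _]n4 -normrM.
  rewrite (polarization sD) //.
  apply: le_trans (ler_normB _ _) _; rewrite normrM i1 mul1r.
  rewrite (_ : 4 = (1 + 1) + (1 + 1)) ?lerD //; last by ring.
  + apply: le_trans (ler_normB _ _) _.
    by apply: lerD; apply: q1; rewrite ?normrN normr1.
  + apply: le_trans (ler_normB _ _) _.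
    by apply: lerD; apply: q1; rewrite ?normrN.
exists (h ^+ 2)^-1; first by rewrite invr_ge0 sqr_ge0.
move=> x y Dx Dy.
have [x0|x0] := eqVneq (rnorm x) 0.
  by rewrite (rnorm_eq0 x0) (s0 y Dy).2 normr0 -(rnorm_eq0 x0) x0 mulr0 mul0r.
have [y0|y0] := eqVneq (rnorm y) 0.
  by rewrite (rnorm_eq0 y0) (s0 x Dx).1 normr0 -(rnorm_eq0 y0) y0 mulr0.
have {}x0 : 0 < rnorm x by rewrite lt0r x0 rnorm_ge0.
have {}y0 : 0 < rnorm y by rewrite lt0r y0 rnorm_ge0.
have to_h z : 0 < rnorm z -> rnorm ((h / rnorm z)%:C *: z) <= h.
  move=> z0; have hz : 0 <= h / rnorm z by rewrite divr_ge0 // ltW.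
  by rewrite rnormZ (ger0_norm hz) divfK // gt_eqF.
have norm_to_h z : 0 < rnorm z -> `|(h / rnorm z)%:C| = (h / rnorm z)%:C.
  by move=> z0; rewrite ger0_norm // lecR divr_ge0 // ltW.
have sZr a u v : D u -> D v -> s u (a *: v) = a * s u v.
  move=> Du Dv; have [+ _] := hs a u v 0 Du Dv D0.
  by rewrite !addr0 (s0 u Du).1 addr0.
have sZl a u v : D u -> D v -> s (a *: u) v = a^*%C * s u v.
  move=> Du Dv; have [_ +] := hs a v u 0 Dv Du D0.
  by rewrite !addr0 (s0 v Dv).2 addr0.
have := small _ _ (DZ (h / rnorm x)%:C _ Dx) (DZ (h / rnorm y)%:C _ Dy)
  (to_h x x0) (to_h y y0).
rewrite sZl ?sZr //; last exact: DZ.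
rewrite !normrM normcJ !norm_to_h // mulrA -rmorphM /= -ler_pdivlMl; last first.
  by rewrite ltcR mulr_gt0 // divr_gt0.
rewrite mulr1 -fmorphV /=; congr (_ <= _%:C).
by field; rewrite !gt_eqF.
Qed.

(** The form lives on a dense subspace while the operator is wanted on the
    whole space, so [riesz] is used twice: first for fixed [y] to obtain the
    adjoint [z y] of the wanted operator on [D], then for an arbitrary vector
    [v] of [H], for the functional [y |-> inner (z y) v]. *)
Lemma bounded_form_operator D (s : H -> H -> R[i]) (M : R) :
  subspace_of D -> dense D -> sesquilinear_on D s -> 0 <= M ->
  (forall x y, D x -> D y -> `|s x y| <= (M * rnorm x * rnorm y)%:C) ->
  exists2 K : H -> H, bounded_operator K &
    forall x y, D x -> D y -> inner x (K y) = s x y.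
Proof.
move=> [D0 DD] dD hs M0 sM.
have /choice[z hz] : forall y, exists z : H, D y ->
    (forall x, D x -> inner z x = s y x) /\ rnorm z <= M * rnorm y.
  move=> y; have [Dy|nDy] := pselect (D y); last by exists 0.
  have [|||z hz] := @riesz R H H D id (fun x => (s y x)^*%C) (M * rnorm y).
  - exact: D0.
  - move=> a v w Dv Dw; split; first exact: DD.
    by split=> //; rewrite (hs a y v w Dy Dv Dw).1 rmorphD rmorphM.
  - move=> v Dv; apply: Re_le_norm; rewrite normcJ; exact: sM.
  exists z => _; split=> [x Dx|]; first by rewrite innerC hz // conjcK.
  apply: (dense_rnorm_le dD); first by rewrite mulr_ge0 ?rnorm_ge0.
  move=> x Dx; rewrite /rinner hz //; apply: Re_le_norm.
  by rewrite normcJ; exact: sM.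
have zlin a u v : D u -> D v -> z (a *: u + v) = a *: z u + z v.
  move=> Du Dv; apply: (dense_inner_eq dD) => x Dx.
  rewrite innerC [RHS]innerC; congr (_^*%C); rewrite innerDl innerZl.
  have Duv := DD a u v Du Dv.
  rewrite (hz _ Duv).1 // (hz _ Du).1 // (hz _ Dv).1 //.
  by rewrite (hs a x u v Dx Du Dv).2.
have /choice[K hK] : forall v, exists w : H,
    (forall y, D y -> inner y w = inner (z y) v) /\ rnorm w <= M * rnorm v.
  move=> v.
  have zM y : D y -> rinner (z y) v <= M * rnorm v * rnorm y.
    move=> Dy; apply: le_trans (rinner_le _ _) _; rewrite mulrAC.
    by rewrite ler_wpM2r ?rnorm_ge0 // (hz y Dy).2.
  have [|||w hw] := @riesz R H H D id (fun y => inner (z y) v) (M * rnorm v).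
  - exact: D0.
  - move=> a u u' Du Du'; split; first exact: DD.
    by split=> //; rewrite zlin // innerDl innerZl.
  - exact: zM.
  exists w; split=> //; apply: (dense_rnorm_le dD).
    by rewrite mulr_ge0 ?rnorm_ge0.
  by move=> y Dy; rewrite /rinner hw //; exact: zM.
exists K; last by move=> x y Dx Dy; rewrite (hK y).1 // (hz x Dx).1.
split=> [a u v|].
  apply: (dense_inner_eq dD) => y Dy.
  by rewrite innerDr innerZr !(hK _).1 // innerDr innerZr.
by exists M => v; rewrite !rnormE -rmorphM lecR; exact: (hK v).2.
Qed.

End Forms.

(** * Bounded operators and commutators *)

Section BoundedOperators.
Context {R : realType} {H : hilbertType R}.
Implicit Types (x y z v : H) (a : R[i]) (D : set H) (K : H -> H).

Lemma bounded_operator_rnorm K : bounded_operator K ->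
  exists2 M : R, 0 <= M & forall x, rnorm (K x) <= M * rnorm x.
Proof.
move=> [_ [M hM]]; exists `|M| => // x.
have := hM x; rewrite !rnormE -rmorphM lecR => /le_trans; apply.
by rewrite ler_wpM2r ?rnorm_ge0 // ler_norm.
Qed.

Lemma bounded_operatorD K x y : bounded_operator K -> K (x + y) = K x + K y.
Proof. by move=> [lK _]; have := lK 1 x y; rewrite !scale1r. Qed.

Lemma bounded_operator0 K : bounded_operator K -> K 0 = 0.
Proof.
move=> bK; have := bounded_operatorD 0 0 bK; rewrite addr0 => /eqP.
by rewrite eq_sym -subr_eq0 addrK => /eqP.
Qed.

Lemma bounded_operatorZ K a x : bounded_operator K -> K (a *: x) = a *: K x.
Proof.
move=> bK; have := bK.1 a x 0.
by rewrite (bounded_operator0 bK) !addr0.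
Qed.

Lemma bounded_operatorB K x y : bounded_operator K -> K (x - y) = K x - K y.
Proof.
move=> bK; rewrite bounded_operatorD // -(scaleN1r y).
by rewrite bounded_operatorZ // scaleN1r.
Qed.

Lemma bounded_operator_comp (S T : H -> H) :
  bounded_operator S -> bounded_operator T -> bounded_operator (S \o T).
Proof.
move=> bS bT; split=> [a x y|]; first by rewrite /= bT.1 bS.1.
have [M M0 hM] := bounded_operator_rnorm bS.
have [N N0 hN] := bounded_operator_rnorm bT.
exists (M * N) => x; rewrite !rnormE -rmorphM lecR /=.
apply: le_trans (hM _) _; rewrite -mulrA; exact: ler_wpM2l.
Qed.

Lemma bounded_operator_add (S T : H -> H) :
  bounded_operator S -> bounded_operator T -> bounded_operator (S \+ T).
Proof.
move=> bS bT; split=> [a x y|]; first by rewrite /= bT.1 bS.1 scalerDr addrACA.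
have [M M0 hM] := bounded_operator_rnorm bS.
have [N N0 hN] := bounded_operator_rnorm bT.
exists (M + N) => x; rewrite !rnormE -rmorphM lecR /= mulrDl.
by apply: le_trans (rnormD _ _) _; apply: lerD.
Qed.

Lemma bounded_operator_cvg {T : Type} (F : set_system T) {FF : Filter F}
    K (u : T -> H) x : bounded_operator K ->
  u @ F --> x -> K \o u @ F --> K x.
Proof.
move=> bK /cvg_rnormP ux; have [M M0 hM] := bounded_operator_rnorm bK.
apply/cvg_rnormP => e e0.
have M1 : 0 < M + 1 by lra.
have := ux (e / (M + 1)) (divr_gt0 e0 M1); apply: filterS => n /=.
rewrite ltr_pdivlMr // -bounded_operatorB // => h.
have := hM (x - u n); have := rnorm_ge0 (x - u n); nra.
Qed.

Lemma bounded_operator_dense_eq D K K' : dense D ->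
  bounded_operator K -> bounded_operator K' ->
  (forall x, D x -> K x = K' x) -> K = K'.
Proof.
move=> dD bK bK' e; apply/funext => x; have [u Du ux] := dense_seq x dD.
have h : K \o u @ \oo --> K x by exact: bounded_operator_cvg.
have h' : K' \o u @ \oo --> K' x by exact: bounded_operator_cvg.
have eKu : K \o u = K' \o u by apply/funext => n /=; exact: e.
by rewrite eKu in h; exact: (cvg_unique (@norm_hausdorff _ H) h h').
Qed.

Lemma sesquilinear_polarization_eq D (s s' : H -> H -> R[i]) :
  subspace_of D -> sesquilinear_on D s -> sesquilinear_on D s' ->
  (forall x, D x -> s x x = s' x x) ->
  forall x y, D x -> D y -> s x y = s' x y.
Proof.
move=> sD hs hs' e x y Dx Dy; apply: (@mulfI _ 4) => //.
have DD a : D (a *: y + x) by exact: sD.2.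
rewrite (polarization sD hs Dx Dy) (polarization sD hs' Dx Dy).
by rewrite !e.
Qed.

Lemma sesquilinear_operator D K : bounded_operator K ->
  sesquilinear_on D (fun x y => inner x (K y)).
Proof.
by move=> bK a x y z _ _ _; rewrite bK.1 innerDr innerZr innerDl innerZl.
Qed.

Lemma bounded_operator_quadratic_eq D K K' :
  subspace_of D -> dense D -> bounded_operator K -> bounded_operator K' ->
  (forall x, D x -> inner x (K x) = inner x (K' x)) -> K = K'.
Proof.
move=> sD dD bK bK' e; apply: (bounded_operator_dense_eq dD bK bK') => y Dy.
apply: (dense_inner_eq dD) => x Dx.
exact: (sesquilinear_polarization_eq sD (sesquilinear_operator bK)
  (sesquilinear_operator bK') e Dx Dy).
Qed.

Section Commutator.
Context {A : operator H} {S : H -> H}.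
Hypotheses (linA : linear_operator A) (denseA : dense (dom A)).
Hypothesis bS : bounded_operator S.

Lemma linear_operator_subspace : subspace_of (dom A).
Proof.
by have [A0 AD] := linA; split=> // a x y Dx Dy; have [] := AD a x y Dx Dy.
Qed.

Lemma sesquilinear_commutator :
  sesquilinear_on (dom A) (fun x y => inner x (S (A y)) - inner (A x) (S y)).
Proof.
move=> a x y z Dx Dy Dz; have [_ ->] := linA.2 a y z Dy Dz.
rewrite !bS.1 !(innerDr, innerDl) !(innerZr, innerZl).
by split; ring.
Qed.

Lemma C1_of_bounded_operator T : bounded_operator T ->
  (forall x, dom A x -> commutator_form S A x = inner x (T x)) -> C1 A S.
Proof.
move=> bT e.
apply: (@subspace_eq_continuous _ _ _ (fun x => inner x (T x) : R[i]^o)).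
  by move=> x /set_mem Dx; rewrite /from_subspace /= e.
apply: continuous_subspaceT => x.
by apply: cvg_inner; [exact: cvg_id|exact: (bounded_operator_cvg (u := id))].
Qed.

Lemma commutator_eq T : bounded_operator T ->
  (forall x, dom A x -> commutator_form S A x = inner x (T x)) ->
  commutator S A = T.
Proof.
move=> bT e; rewrite /commutator; case: xgetP => [T' -> [bT' e']|/(_ T)].
  have sA := linear_operator_subspace.
  apply: (bounded_operator_quadratic_eq sA denseA) => // x Dx.
  by rewrite e' // e.
by case; split => // x Dx; rewrite e.
Qed.

Lemma commutatorP : C1 A S ->
  bounded_operator (commutator S A) /\
  forall x y, dom A x -> dom A y ->
    inner x (commutator S A y) = inner x (S (A y)) - inner (A x) (S y).
Proof.
move=> cS; have sA := linear_operator_subspace.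
have [M M0 hM] := continuous_form_bounded sA sesquilinear_commutator cS.
have [K bK hK] := bounded_form_operator sA denseA sesquilinear_commutator M0 hM.
by rewrite (commutator_eq bK) // => x Dx; rewrite hK.
Qed.

End Commutator.

Section SelfAdjoint.
Context {A : operator H}.
Hypothesis hA : selfadjoint A.

Lemma selfadjoint_symmetric x y : dom A x -> dom A y ->
  inner x (A y) = inner (A x) y.
Proof.
case: hA => _ _ adjA Dx Dy.
by have : adjoint_graph A (x, A x) by [rewrite adjA]; exact.
Qed.

Lemma selfadjoint_dom u v : (forall x, dom A x -> inner u (A x) = inner v x) ->
  dom A u /\ v = A u.
Proof.
by case: hA => _ _ adjA h; have : graph A (u, v) by rewrite -adjA.
Qed.

(** The form identity [<A y, S x> = <y, S A x - [S, A] x>], for all [y] in the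
    domain of [A], says that [S x] lies in the domain of the adjoint of [A]. *)
Lemma C1_dom S x : bounded_operator S -> C1 A S -> dom A x ->
  dom A (S x) /\ A (S x) = S (A x) - commutator S A x.
Proof.
move=> bS cS Dx; case: (hA) => linA dA _.
have [_ hK] := commutatorP linA dA bS cS.
have [|? <-] := @selfadjoint_dom (S x) (S (A x) - commutator S A x); last by [].
move=> y Dy; rewrite innerC [RHS]innerC; congr (_^*%C).
by rewrite innerBr hK // subKr.
Qed.

End SelfAdjoint.

End BoundedOperators.

Section LinearOperator.
Context {R : realType} {H : hilbertType R} {A : operator H}.
Hypothesis linA : linear_operator A.
Implicit Types (x y : H) (a : R[i]).

Lemma dom_lin a x y : dom A x -> dom A y -> dom A (a *: x + y).
Proof. by move=> Dx Dy; have [] := linA.2 a x y Dx Dy. Qed.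

Lemma app_lin a x y : dom A x -> dom A y -> A (a *: x + y) = a *: A x + A y.
Proof. by move=> Dx Dy; have [] := linA.2 a x y Dx Dy. Qed.

Lemma app0 : A 0 = 0.
Proof.
have := app_lin 1 linA.1 linA.1; rewrite !scale1r addr0 => /eqP.
by rewrite eq_sym -subr_eq0 addrK => /eqP.
Qed.

Lemma domZ a x : dom A x -> dom A (a *: x).
Proof. by move=> Dx; have := dom_lin a Dx linA.1; rewrite addr0. Qed.

Lemma appZ a x : dom A x -> A (a *: x) = a *: A x.
Proof. by move=> Dx; have := app_lin a Dx linA.1; rewrite app0 !addr0. Qed.

Lemma domD x y : dom A x -> dom A y -> dom A (x + y).
Proof. by move=> Dx Dy; rewrite -(scale1r x); exact: dom_lin. Qed.

Lemma appD x y : dom A x -> dom A y -> A (x + y) = A x + A y.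
Proof. by move=> Dx Dy; rewrite -(scale1r x) app_lin // !scale1r. Qed.

Lemma domB x y : dom A x -> dom A y -> dom A (x - y).
Proof.
by move=> Dx Dy; rewrite -(scaleN1r y); apply: domD => //; exact: domZ.
Qed.

Lemma appB x y : dom A x -> dom A y -> A (x - y) = A x - A y.
Proof.
move=> Dx Dy; have DNy := domZ (-1) Dy.
by rewrite -(scaleN1r y) appD // appZ // scaleN1r.
Qed.

End LinearOperator.

(** * Resolvents of a self-adjoint operator *)

Section Resolvent.
Context {R : realType} {H : hilbertType R} (A : operator H).
Hypothesis hA : selfadjoint A.
Implicit Types (u v w x y z : H) (a : R[i]) (t : R).

Let linA : linear_operator A. Proof. by case: hA. Qed.

(** The cross term [2 Re <x, i t A x>] vanishes because [<x, A x>] is real. *)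
Lemma rnorm_sqr_shift t x : dom A x ->
  rnorm (x + (t%:C * 'i) *: A x) ^+ 2 =
  rnorm x ^+ 2 + t ^+ 2 * rnorm (A x) ^+ 2.
Proof.
move=> Dx; rewrite rnorm_sqrD -scalerA rnorm_sqrZ rnormZi rinnerZr.
suff -> : rinner x ('i *: A x) = 0 by rewrite !mulr0 addr0.
have := innerC x (A x); rewrite -(selfadjoint_symmetric hA Dx Dx).
rewrite /rinner innerZr; case: (inner x (A x)) => p q [] /= h.
by rewrite mul0r mul1r; lra.
Qed.

(** That is, [z = (1 + i t A)^-1 v]. *)
Definition resolvent t v z := dom A z /\ z + (t%:C * 'i) *: A z = v.

(** Applied to [L w = w - i t A w], which satisfies [|w| <= |L w|], Riesz's
    theorem gives a [z] with [<w - i t A w, z> = <w, v>] for all [w] in the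
    domain of [A].  Read as a statement on the adjoint of [A], this says that
    [i t z] is in its domain and is mapped to [v - z]. *)
Lemma resolvent_exists t v : t != 0 -> exists z, resolvent t v z.
Proof.
move=> t0.
pose L w := w - (t%:C * 'i) *: A w.
have LE w : L w = w + ((- t)%:C * 'i) *: A w.
  by rewrite /L rmorphN mulNr scaleNr.
have [|||z hz] := @riesz R H H (dom A) L (fun w => inner w v) (rnorm v).
- exact: linA.1.
- move=> a x y Dx Dy; split; first exact: dom_lin.
  split; last by rewrite innerDl innerZl.
  rewrite /L app_lin // !scalerDr !scalerN !scalerA opprD addrACA.
  by rewrite mulrC.
- move=> w Dw; apply: le_trans (rinner_le _ _) _; rewrite mulrC.
  rewrite ler_wpM2l ?rnorm_ge0 // -(@ler_pXn2r _ 2) ?nnegrE ?rnorm_ge0 //.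
  by rewrite LE rnorm_sqr_shift // lerDl mulr_ge0 ?sqr_ge0.
set c := t%:C * 'i.
have cJ : c^*%C = - c.
  rewrite /c; apply/eqP; rewrite eq_complex /=.
  by apply/andP; split; apply/eqP; ring.
have c0 : c != 0.
  rewrite mulf_neq0 //; first by apply: contra t0 => /eqP[->].
  by rewrite eq_complex /= oner_eq0 andbF.
have [x Dx|Dcz e] := @selfadjoint_dom _ _ _ hA (c *: z) (v - z).
  have := congr1 conjc (hz x Dx); rewrite -!innerC innerBr innerZr -/c => e.
  by rewrite innerBl -e innerZl cJ mulNr addrAC subrr add0r.
have Dz : dom A z by rewrite -(scalerK c0 z); exact: domZ.
exists z; split => //; rewrite -appZ // -e.
by rewrite addrC subrK.
Qed.

Lemma resolventB t v v' z z' : resolvent t v z -> resolvent t v' z' ->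
  resolvent t (v - v') (z - z').
Proof.
move=> [Dz <-] [Dz' <-]; split; first exact: domB.
by rewrite appB // scalerBr addrACA -opprD.
Qed.

Lemma resolvent_rnorm t v z : resolvent t v z -> rnorm z <= rnorm v.
Proof.
move=> [Dz <-]; rewrite -(@ler_pXn2r _ 2) ?nnegrE ?rnorm_ge0 //.
by rewrite rnorm_sqr_shift // lerDl mulr_ge0 ?sqr_ge0.
Qed.

Lemma resolvent_rnormB t v z : resolvent t v z -> rnorm (v - z) <= rnorm v.
Proof.
move=> [Dz <-]; rewrite -(@ler_pXn2r _ 2) ?nnegrE ?rnorm_ge0 //.
rewrite rnorm_sqr_shift // addrAC subrr add0r -scalerA rnorm_sqrZ rnormZi.
by rewrite lerDr sqr_ge0.
Qed.

Lemma resolvent_unique t v z z' : resolvent t v z -> resolvent t v z' -> z = z'.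
Proof.
move=> h h'; apply/subr0_eq/rnorm_eq0/le_anti; rewrite rnorm_ge0 andbT.
apply: le_trans (resolvent_rnorm (resolventB h h')) _.
by rewrite subrr /rnorm normr0.
Qed.

Lemma resolvent_app t v z : t != 0 -> dom A v -> resolvent t v z ->
  resolvent t (A v) (A z).
Proof.
move=> t0 Dv [Dz e]; set c := t%:C * 'i in e *.
have c0 : c != 0.
  rewrite mulf_neq0 //; first by apply: contra t0 => /eqP[->].
  by rewrite eq_complex /= oner_eq0 andbF.
have e' : c *: A z = v - z by rewrite -e addrC addKr.
have DAz : dom A (A z).
  by rewrite -(scalerK c0 (A z)) e'; apply: domZ => //; exact: domB.
split => //; rewrite -/c -appZ // e' appB //.
by rewrite addrC subrK.
Qed.

(** The resolvent commutes with [A], so the error [v - z = i t A z] is [i t]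
    times the resolvent of [A v]. *)
Lemma resolvent_rate t v z : t != 0 -> dom A v -> resolvent t v z ->
  rnorm (v - z) <= `|t| * rnorm (A v).
Proof.
move=> t0 Dv h; have h' := resolvent_app t0 Dv h; case: h => [Dz e].
have -> : v - z = (t%:C * 'i) *: A z by rewrite -e addrC addKr.
rewrite -scalerA rnormZ rnormZi.
by rewrite ler_wpM2l //; exact: resolvent_rnorm h'.
Qed.

(** Strong convergence of the resolvents to the identity, in the stronger form
    that allows the argument to vary: the rate [resolvent_rate] on the dense
    domain extends by the uniform bound [resolvent_rnormB]. *)
Lemma resolvent_cvg (v z : nat -> H) (l : H) :
  v @ \oo --> l -> (forall n, resolvent n.+1%:R^-1 (v n) (z n)) ->
  z @ \oo --> l.
Proof.
move=> /cvg_rnormP vl vz; apply/cvg_rnormP => e e0.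
have dA : dense (dom A) by case: hA.
have e4 : 0 < e / 4 by rewrite divr_gt0.
have [u Du lu] := dense_rnorm dA l e4.
have M0 : 0 < rnorm (A u) + 1 by have := rnorm_ge0 (A u); lra.
have [N hN] := invS_small (divr_gt0 e4 M0).
have [N' _ hN'] := vl _ e4.
exists (maxn N N') => // n /=; rewrite geq_max => /andP[Nn N'n].
have {}hN := hN n Nn; have {}hN' := hN' n N'n.
have t0 : (n.+1%:R^-1 : R) != 0 by rewrite invr_neq0 // pnatr_eq0.
have tp : 0 < (n.+1%:R^-1 : R) by rewrite invr_gt0.
have [y uy] := resolvent_exists u t0.
have h1 := resolvent_rnormB (resolventB (vz n) uy).
have := resolvent_rate t0 Du uy; rewrite (gtr0_norm tp) => h2.
have -> : l - z n = (l - v n) + ((v n - u - (z n - y)) + (u - y)).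
  by rewrite opprB (addrAC (v n - u)) !subrKA.
have := rnormD (l - v n) ((v n - u - (z n - y)) + (u - y)).
have := rnormD (v n - u - (z n - y)) (u - y).
have : rnorm (v n - u) <= rnorm (l - v n) + rnorm (l - u).
  by rewrite (rnormB l (v n)) -[v n - u](subrKA l) rnormD.
move: hN hN' lu h1 h2; rewrite ltr_pdivlMr //.
move: (n.+1%:R^-1) (rnorm_ge0 (A u)) tp => p; nra.
Qed.

End Resolvent.

(** * Adjoints and closures *)

Section Adjoints.
Context {R : realType} {H : hilbertType R}.
Implicit Types (u v w x y z : H) (T : operator H) (G : set (H * H)).

Lemma closed_inner_eq (f g f' g' : H * H -> H) :
  continuous f -> continuous g -> continuous f' -> continuous g' ->
  closed [set p | inner (f p) (g p) = inner (f' p) (g' p)].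
Proof.
move=> cf cg cf' cg'.
pose d p : R[i]^o := inner (f p) (g p) - inner (f' p) (g' p).
have -> : [set p | inner (f p) (g p) = inner (f' p) (g' p)] = d @^-1` [set 0].
  apply/seteqP; split=> p /=; rewrite /d; first by move=> ->; rewrite subrr.
  exact: subr0_eq.
apply: closed_comp.
  move=> p _; apply: (@cvgB _ R[i]^o); apply: cvg_inner;
    [exact: cf|exact: cg|exact: cf'|exact: cg'].
have hR := @norm_hausdorff _ R[i]^o.
exact: (accessible_closed_set1 (hausdorff_accessible hR)).
Qed.

Lemma closed_adjoint_graph T : closed (adjoint_graph T).
Proof.
have -> : adjoint_graph T =
    \bigcap_(x in dom T) [set p | inner p.1 (T x) = inner p.2 x].
  by apply/seteqP; split=> p h x; exact: h.
apply: closed_bigI => x _.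
apply: (closed_inner_eq (f := fst) (g := fun=> T x) (f' := snd)
  (g' := fun=> x)) => p; by [exact: cvg_fst|exact: cvg_cst|exact: cvg_snd].
Qed.

Lemma graph_operator_of_graph G :
  (forall x y y', G (x, y) -> G (x, y') -> y = y') ->
  graph (operator_of_graph G) = G.
Proof.
move=> GF; apply/seteqP; split=> -[x y] /=.
  by move=> [[z Gz]] /= ->; case: xgetP => [w ->//|/(_ z)].
move=> Gxy; split; first by exists y.
by rewrite /=; case: xgetP => [w _ Gw|/(_ y)//]; exact: GF Gxy Gw.
Qed.

(** Orthogonality to the graph of [T] is a closed condition. *)
Lemma adjoint_graph_closure T :
  graph (operator_closure T) = closure (graph T) ->
  adjoint_graph (operator_closure T) = adjoint_graph T.
Proof.
move=> gcl; apply/seteqP; split=> p h x Dx.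
  have [Dx' e] : graph (operator_closure T) (x, T x).
    by rewrite gcl; apply: subset_closure.
  by rewrite (e : T x = operator_closure T x); exact: h.
have : closure (graph T) (x, operator_closure T x) by rewrite -gcl.
suff : closure (graph T) `<=` [set q | inner p.1 q.2 = inner p.2 q.1].
  by move=> /[apply].
rewrite closureE => q; apply; split.
  apply: (closed_inner_eq (f := fun=> p.1) (g := snd) (f' := fun=> p.2)
    (g' := fst)) => r; by [exact: cvg_fst|exact: cvg_cst|exact: cvg_snd].
by move=> [y _] [/= Dy ->]; exact: h.
Qed.

End Adjoints.

(** * The anticommutator *)

Section Anticommutator.
Context {R : realType} {H : hilbertType R} {A : operator H} {B : H -> H}.
Hypotheses (hA : selfadjoint A) (hB : bounded_selfadjoint B) (hBA : C1 A B).
Implicit Types (u v w x y z : H).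

Let linA : linear_operator A. Proof. by case: hA. Qed.
Let denseA : dense (dom A). Proof. by case: hA. Qed.
Let bB : bounded_operator B. Proof. by case: hB. Qed.

Local Notation K := (commutator B A).
Local Notation AB := (anticommutator A B).

Let bK : bounded_operator K.
Proof. by have [] := commutatorP linA denseA bB hBA. Qed.

Let innerK x y : dom A x -> dom A y ->
  inner x (K y) = inner x (B (A y)) - inner (A x) (B y).
Proof. by have [_] := commutatorP linA denseA bB hBA; exact. Qed.

Let domB_ x : dom A x -> dom A (B x).
Proof. by move=> Dx; have [] := C1_dom hA bB hBA Dx. Qed.

Let appB_ x : dom A x -> A (B x) = B (A x) - K x.
Proof. by move=> Dx; have [] := C1_dom hA bB hBA Dx. Qed.

Let innerB x y : inner x (B y) = inner (B x) y. Proof. exact: hB.2. Qed.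

(** On the domain of [A] this is the symmetry of [A] and [B]; one of the two
    arguments then extends to the whole space by density. *)
Lemma commutator_antiadjoint x y : dom A x -> inner y (K x) = - inner (K y) x.
Proof.
move=> Dx; have [u Du uy] := dense_seq y denseA.
have h1 : (fun n => inner (u n) (K x) : R[i]^o) @ \oo -->
    (inner y (K x) : R[i]^o).
  by apply: cvg_inner => //; exact: cvg_cst.
have h2 : (fun n => - inner (K (u n)) x : R[i]^o) @ \oo -->
    (- inner (K y) x : R[i]^o).
  apply: (@cvgN _ R[i]^o); apply: cvg_inner; last exact: cvg_cst.
  exact: bounded_operator_cvg.
have e : (fun n => inner (u n) (K x) : R[i]^o) = (fun n => - inner (K (u n)) x).
  apply/funext => n; rewrite innerK // (innerC x) innerK // rmorphB /= -!innerC.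
  by rewrite opprB !innerB.
by rewrite e in h1; exact: (cvg_unique (@norm_hausdorff _ R[i]^o) h1 h2).
Qed.

Definition anticommutator_closure_graph : set (H * H) :=
  [set p | dom A (B p.1) /\ p.2 = 2 *: A (B p.1) + K p.1].
Local Notation G := anticommutator_closure_graph.

(** On the domain of [A] the operator is [2 BA - K].  Moving [B] and [K] to the
    other side of the inner product turns the condition defining the adjoint
    into the condition that [(2 B u, v - K u)] be in the graph of the adjoint of
    [A], that is, of [A] itself. *)
Lemma adjoint_graph_anticommutator : adjoint_graph AB = G.
Proof.
apply/seteqP; split=> -[u v] /= h.
  have [|D2 e] := @selfadjoint_dom _ _ _ hA (2 *: B u) (v - K u).
    move=> x Dx; have /= := h x Dx; rewrite appB_ // => e.
    have hk := commutator_antiadjoint u Dx.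
    rewrite innerBl -e !(innerDr, innerNr) innerB hk innerZl.
    by rewrite conjc_nat; ring.
  have n2 : (2 : R[i]) != 0 by [].
  have Du : dom A (B u) by rewrite -(scalerK n2 (B u)); exact: domZ.
  by split => //=; rewrite -appZ // -e subrK.
move=> x Dx /=; case: h => /= Du ->.
rewrite innerDl innerZl conjc_nat appB_ // !(innerDr, innerNr).
have -> : inner (K u) x = - inner u (K x).
  by rewrite commutator_antiadjoint // opprK.
by rewrite innerB (selfadjoint_symmetric hA) //; ring.
Qed.

Lemma anticommutatorE x : dom A x -> AB x = 2 *: A (B x) + K x.
Proof.
move=> Dx; rewrite /= appB_ //.
by rewrite scalerBr !scaler_nat !mulr2n opprD !addrA subrK addrAC.
Qed.

(** One inclusion holds because adjoints are closed.  For the other, [phi] is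
    approximated by its resolvents [z n]; then [A (B (z n))] differs from the
    resolvent [p n] of [A (B phi)] by [K (z n)] minus its resolvent [q n], and
    this difference tends to [K phi - K phi]. *)
Lemma closure_graph_anticommutator : closure (graph AB) = G.
Proof.
apply/seteqP; split.
  rewrite closureE => p; apply; split.
    by rewrite -adjoint_graph_anticommutator; exact: closed_adjoint_graph.
  move=> [x _] [/= Dx ->]; split; first exact: domB_.
  exact: anticommutatorE.
move=> [phi _] [/= DBphi ->].
have t0 n : (n.+1%:R^-1 : R) != 0 by rewrite invr_neq0 // pnatr_eq0.
have /choice[z zP] : forall n, exists z, resolvent A n.+1%:R^-1 phi z.
  by move=> n; exact: (resolvent_exists hA _ (t0 n)).
have zl : z @ \oo --> phi.
  by apply: (resolvent_cvg hA (v := fun=> phi)) => //; exact: cvg_cst.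
have /choice[q qP] : forall n, exists q, resolvent A n.+1%:R^-1 (K (z n)) q.
  by move=> n; exact: (resolvent_exists hA _ (t0 n)).
have Kzl : K \o z @ \oo --> K phi by exact: bounded_operator_cvg.
have ql : q @ \oo --> K phi by exact: (resolvent_cvg hA (v := K \o z)).
have /choice[p pP] : forall n, exists p, resolvent A n.+1%:R^-1 (A (B phi)) p.
  by move=> n; exact: (resolvent_exists hA _ (t0 n)).
have pl : p @ \oo --> A (B phi).
  by apply: (resolvent_cvg hA (v := fun=> A (B phi))) => //; exact: cvg_cst.
have ABz n : A (B (z n)) = p n - (K (z n) - q n).
  have [Dz ez] := zP n; have [Dq eq] := qP n.
  have DBz := domB_ Dz.
  set c := (n.+1%:R^-1)%:C * 'i in ez eq.
  (* Applying [B] to the equation of [z n] leaves the term [- c *: K (z n)],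
     which the summand [c *: q n] compensates. *)
  have h : resolvent A n.+1%:R^-1 (B phi) (B (z n) + c *: q n).
    split; first by apply: domD => //; exact: domZ.
    rewrite -/c (appD linA) ?(appZ linA) //; last exact: domZ.
    rewrite -ez (bounded_operatorD _ _ bB) (bounded_operatorZ _ _ bB) appB_ //.
    by rewrite -eq opprD addrA subrK scalerBr addrACA subrr addr0.
  have h' := resolvent_app hA (t0 n) DBphi h.
  have := resolvent_unique hA h' (pP n).
  rewrite (appD linA) ?(appZ linA) //; last exact: domZ.
  by move=> <-; rewrite -eq [q n + _]addrC !addrK.
have Dz n : dom A (z n) by have [] := zP n.
apply: (@closed_cvg _ _ \oo _ (fun n => (z n, AB (z n))) (closure (graph AB))).
- exact: closed_closure.
- by apply: nearW => n; apply: subset_closure; split => //=.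
apply: cvg_pair => //=.
have -> : (fun n => A (B (z n)) + B (A (z n))) =
   (fun n => 2 *: (p n - (K (z n) - q n)) + K (z n)).
  apply/funext => n; rewrite -ABz; exact: anticommutatorE.
apply: cvgD => //; apply: cvgZ; first exact: cvg_cst.
rewrite -[X in _ --> X]subr0 -(subrr (K phi)).
by apply: cvgB => //; apply: cvgB.
Qed.

Lemma linear_anticommutator : linear_operator AB.
Proof.
split=> [|a x y Dx Dy]; first exact: linA.1.
split; first exact: (dom_lin linA a Dx Dy).
rewrite /= bB.1 !(app_lin linA) //; try exact: domB_.
by rewrite bB.1 scalerDr addrACA.
Qed.

Local Notation A_B := (operator_closure AB).

Lemma graph_closure_anticommutator : graph A_B = G.
Proof.
rewrite graph_operator_of_graph ?closure_graph_anticommutator // => x y y'.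
by move=> [_ /= ->] [_ /= ->].
Qed.

Lemma dom_closure_anticommutator : dom A_B = [set x | dom A (B x)].
Proof.
apply/seteqP; split=> x.
  by move=> Dx; have [] : G (x, A_B x) by rewrite -graph_closure_anticommutator.
move=> Dx; have : G (x, 2 *: A (B x) + K x) by [].
by rewrite -graph_closure_anticommutator => -[].
Qed.

Lemma closure_anticommutatorE x : dom A (B x) -> A_B x = 2 *: A (B x) + K x.
Proof.
move=> Dx; have : G (x, 2 *: A (B x) + K x) by [].
by rewrite -graph_closure_anticommutator => -[_ e]; exact: esym e.
Qed.

Lemma essentially_selfadjoint_anticommutator : essentially_selfadjoint AB.
Proof.
split; first exact: linear_anticommutator.
  move=> y; rewrite closure_graph_anticommutator => -[/= _ ->].
  rewrite !(bounded_operator0 bB) (app0 linA) scaler0.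
  by rewrite (bounded_operator0 bK) addr0.
split.
- rewrite /linear_operator dom_closure_anticommutator; split.
    by rewrite /= (bounded_operator0 bB); exact: linA.1.
  move=> a x y Dx Dy; have Dxy : dom A (B (a *: x + y)).
    by rewrite bB.1; exact: (dom_lin linA).
  split=> //; rewrite !closure_anticommutatorE // bB.1 (app_lin linA) // bK.1.
  by rewrite !scalerDr !scalerA mulrC addrACA.
- rewrite dom_closure_anticommutator => O O0 oO.
  have [x [Ox Dx]] := denseA O0 oO.
  by exists x; split=> //; exact: domB_.
rewrite graph_closure_anticommutator adjoint_graph_closure.
  exact: adjoint_graph_anticommutator.
by rewrite graph_closure_anticommutator closure_graph_anticommutator.
Qed.

Section CommutingOperator.
Context {C : H -> H}.
Hypotheses (bC : bounded_operator C) (hCA : C1 A C).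
Hypothesis CB : forall x, B (C x) = C (B x).

Local Notation L := (commutator C A).

Let bL : bounded_operator L.
Proof. by have [] := commutatorP linA denseA bC hCA. Qed.

(** The Jacobi identity [[C, [B, A]] = [B, [C, A]]] for commuting [B] and [C],
    arranged without subtraction.  It is a computation on the domain of [A];
    both sides are bounded, so it holds on the whole space. *)
Lemma jacobi_commutator x : C (K x) + L (B x) = K (C x) + B (L x).
Proof.
suff : (C \o K) \+ (L \o B) = (K \o C) \+ (B \o L) by move=> /(congr1 (@^~ x)).
apply: (bounded_operator_dense_eq denseA).
- by apply: bounded_operator_add; exact: bounded_operator_comp.
- by apply: bounded_operator_add; exact: bounded_operator_comp.
move=> {}x Dx /=.
have KE y : dom A y -> K y = B (A y) - A (B y).
  by move=> Dy; rewrite appB_ // subKr.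
have LE y : dom A y -> L y = C (A y) - A (C y).
  by move=> Dy; rewrite (C1_dom hA bC hCA Dy).2 subKr.
have DC : dom A (C x) by have [] := C1_dom hA bC hCA Dx.
rewrite !KE // !LE //; last exact: domB_.
rewrite (bounded_operatorB _ _ bC) (bounded_operatorB _ _ bB) !CB subrKA.
by rewrite [RHS]addrC subrKA.
Qed.

(** Since [C] preserves the domain of the self-adjoint closure, the form is the
    expectation of a genuine operator commutator, in which the terms
    [2 L B + [C, K]] are evaluated by [jacobi_commutator]. *)
Lemma commutator_form_closure_anticommutator x : dom A_B x ->
  commutator_form C A_B x = inner x (L (B x) + B (L x)).
Proof.
rewrite dom_closure_anticommutator /= => Dx.
have [DCB ACB] := C1_dom hA bC hCA Dx.
have DBC : dom A (B (C x)) by rewrite CB.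
have DAB y : dom A (B y) -> dom A_B y by rewrite dom_closure_anticommutator.
have symA_B : inner (A_B x) (C x) = inner x (A_B (C x)).
  have [_ _ [_ _ adjAB]] := essentially_selfadjoint_anticommutator.
  have h : adjoint_graph A_B (x, A_B x).
    by rewrite adjAB; split=> //; exact: DAB.
  exact: esym (h (C x) (DAB _ DBC)).
rewrite /commutator_form symA_B -innerBr; congr inner.
rewrite !closure_anticommutatorE // CB ACB.
rewrite (bounded_operatorD _ _ bC) (bounded_operatorZ _ _ bC) scalerBr.
have -> : C (K x) = K (C x) + B (L x) - L (B x).
  by rewrite -jacobi_commutator addrK.
move: (2 *: _) (K _) (B (L x)) (L _) => a k b l.
apply/eqP; rewrite subr_eq [eqbRHS]addrC scaler_nat mulr2n -!addrA; apply/eqP.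
congr (a + _); rewrite [RHS]addrCA; congr (k + _).
by rewrite opprD -addrA addKr addrC.
Qed.

Lemma C1_closure_anticommutator : C1 A_B C.
Proof.
apply: C1_of_bounded_operator commutator_form_closure_anticommutator.
by apply: bounded_operator_add; exact: bounded_operator_comp.
Qed.

Lemma commutator_closure_anticommutator :
  commutator C A_B = (fun x => L (B x) + B (L x)).
Proof.
have [_ _ [lin dA_B _]] := essentially_selfadjoint_anticommutator.
apply: commutator_eq commutator_form_closure_anticommutator => //.
by apply: bounded_operator_add; exact: bounded_operator_comp.
Qed.

End CommutingOperator.

End Anticommutator.

Theorem lemma2p4 (R : realType) (H : hilbertType R)
    (A : operator H) (hA : selfadjoint A)
    (B : H -> H) (hB : bounded_selfadjoint B) (hBA : C1 A B) :
  let A_B := operator_closure (anticommutator A B) in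
  ((forall phi, dom A phi -> dom A (B phi)) /\
   essentially_selfadjoint (anticommutator A B) /\
   dom A_B = [set phi : H | dom A (B phi)]) /\
  (forall C : H -> H,
    bounded_operator C -> C1 A C -> B \o C = C \o B ->
    C1 A_B C /\
    commutator C A_B =
      (fun phi => commutator C A (B phi) + B (commutator C A phi))).

Proof.
split; last first.
  move=> C bC hCA eBC.
  have CB x : B (C x) = C (B x) by have := congr1 (@^~ x) eBC.
  split; first exact: C1_closure_anticommutator.
  exact: commutator_closure_anticommutator.
split; first by move=> phi; case: hB => bB _; case/(C1_dom hA bB hBA).
split; first exact: essentially_selfadjoint_anticommutator.
exact: dom_closure_anticommutator.
Qed.
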